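(* Consider a strip-plot design with $B\ge 2$ blocks, each a $P\times Q$ array of units, $P,Q\ge2$, and let $l(pq)$ ($1\le p\le P$, $1\le q\le Q$) be known real constants, not all zero, summing to zero. With $\bar\tau_b,\bar\tau,\hat{\bar\tau}_b,\hat{\bar\tau}$ as defined in the context, let $$\widehat{\operatorname{var}}_0(\hat{\bar\tau})=\frac{1}{B(B-1)}\sum_{b=1}^B(\hat{\bar\tau}_b-\hat{\bar\tau})^2 .$$ Then $$E\{\widehat{\operatorname{var}}_0(\hat{\bar\tau})\}=\operatorname{var}(\hat{\bar\tau})+\Delta_0,\qquad\text{where}\quad \Delta_0=\frac{1}{B(B-1)}\sum_{b=1}^B(\bar\tau_b-\bar\tau)^2 .$$
   Context: Setup. Factors $F$ and $G$ have levels $1,\dots,P$ and $1,\dots,Q$ respectively ($P,Q\ge 2$); the treatment combinations are $pq$, $1\le p\le P$, $1\le q\le Q$. There are $BPQ$ experimental units arranged in $B\ge 2$ blocks, each block being a $P\times Q$ array of units (rows $r=1,\dots,P$, columns $c=1,\dots,Q$). Strip-plot randomization: independently for each block $b$, and independently for rows and columns within each block, the levels $1,\dots,P$ of $F$ are assigned to the $P$ rows by a uniformly random permutation (one row per level), and the levels $1,\dots,Q$ of $G$ are assigned to the $Q$ columns by a uniformly random permutation (one column per level). The unit in block $b$ assigned to treatment combination $pq$ is the one whose row is assigned to level $p$ of $F$ and whose column is assigned to level $q$ of $G$. Potential outcomes: $Y_b(rc;pq)$ is a fixed (nonrandom) real number, the outcome of the unit at row $r$ and column $c$ of block $b$ when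 exposed to treatment combination $pq$. All randomness comes from the randomization; expectation $E$ and variance are with respect to it. $Y_b^{\rm obs}(pq)$ denotes the outcome observed in block $b$ from the unit assigned to $pq$, i.e. $Y_b^{\rm obs}(pq)=Y_b(rc;pq)$ with $r$, $c$ the (random) row and column in block $b$ assigned to level $p$ of $F$ and level $q$ of $G$. Definitions: $\bar Y_b(pq)=\frac{1}{PQ}\sum_{r=1}^P\sum_{c=1}^Q Y_b(rc;pq)$; $\bar\tau_b=\sum_{p=1}^P\sum_{q=1}^Q l(pq)\bar Y_b(pq)$; $\bar\tau=\frac1B\sum_{b=1}^B\bar\tau_b$; $\hat{\bar\tau}_b=\sum_{p=1}^P\sum_{q=1}^Q l(pq)Y_b^{\rm obs}(pq)$; $\hat{\bar\tau}=\frac1B\sum_{b=1}^B\hat{\bar\tau}_b$. *)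

(* Defs.v *)
From mathcomp Require Export all_boot all_order all_algebra all_fingroup.
From mathcomp Require Export all_classical all_reals all_analysis.

Set Implicit Arguments.
Unset Strict Implicit.
Unset Printing Implicit Defensive.

Import Order.TTheory GRing.Theory Num.Theory.

Local Open Scope classical_set_scope.
Local Open Scope ring_scope.

(* [rowF b w p] is the row of block b that receives level p of F, and
   [colG b w q] the column of block b that receives level q of G.
   The levels, rows and columns 1, ..., n are represented by 'I_n.
   In [strip_indep] some of the sets may be the full set, so that the product
   rule covers every subfamily of the 2B permutations. *)
Record strip_plot_randomization (R : realType) (d : measure_display)
    (Omega : measurableType d) (Pr : probability Omega R) (B P Q : nat)
    (rowF : 'I_B -> Omega -> 'S_P) (colG : 'I_B -> Omega -> 'S_Q) : Prop := {
  rowF_measurable : forall (b : 'I_B) (s : 'S_P),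
    measurable [set w | rowF b w = s];
  colG_measurable : forall (b : 'I_B) (t : 'S_Q),
    measurable [set w | colG b w = t];
  rowF_uniform : forall (b : 'I_B) (s : 'S_P),
    Pr [set w | rowF b w = s] = ((P`!)%:R^-1)%:E;
  colG_uniform : forall (b : 'I_B) (t : 'S_Q),
    Pr [set w | colG b w = t] = ((Q`!)%:R^-1)%:E;
  strip_indep : forall (S : 'I_B -> {set 'S_P}) (T : 'I_B -> {set 'S_Q}),
    Pr [set w | forall b : 'I_B, rowF b w \in S b /\ colG b w \in T b]
    = ((\prod_(b < B) Pr [set w | rowF b w \in S b])
       * (\prod_(b < B) Pr [set w | colG b w \in T b]))%E }.

Section StripPlot.
Context {R : realType} {Omega : Type} {B P Q : nat}.

(* [Y b r c p q] is the potential outcome written Y_b(rc;pq). *)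
Variable Y : 'I_B -> 'I_P -> 'I_Q -> 'I_P -> 'I_Q -> R.
Variable l : 'I_P -> 'I_Q -> R.
Variables (rowF : 'I_B -> Omega -> 'S_P) (colG : 'I_B -> Omega -> 'S_Q).

Definition Ybar (b : 'I_B) (p : 'I_P) (q : 'I_Q) : R :=
  (P * Q)%:R^-1 * \sum_(r < P) \sum_(c < Q) Y b r c p q.

Definition taubar_block (b : 'I_B) : R :=
  \sum_(p < P) \sum_(q < Q) l p q * Ybar b p q.

Definition taubar : R := B%:R^-1 * \sum_(b < B) taubar_block b.

Definition Yobs (b : 'I_B) (p : 'I_P) (q : 'I_Q) (w : Omega) : R :=
  Y b (rowF b w p) (colG b w q) p q.

Definition tauhat_block (b : 'I_B) (w : Omega) : R :=
  \sum_(p < P) \sum_(q < Q) l p q * Yobs b p q w.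

Definition tauhat (w : Omega) : R :=
  B%:R^-1 * \sum_(b < B) tauhat_block b w.

Definition varhat0 (w : Omega) : R :=
  (B * (B - 1))%:R^-1 * \sum_(b < B) (tauhat_block b w - tauhat w) ^+ 2.

Definition Delta0 : R :=
  (B * (B - 1))%:R^-1 * \sum_(b < B) (taubar_block b - taubar) ^+ 2.

End StripPlot.

(* Main.v *)
Require Import Defs.
From mathcomp Require Import ring.

Import Order.TTheory GRing.Theory Num.Theory.

Set Implicit Arguments.
Unset Strict Implicit.
Unset Printing Implicit Defensive.

Local Open Scope ring_scope.

(** Everything random is a function of the assignment, the family of the [2B]
    permutations.  It takes finitely many values and, by independence and
    uniformity of its components, is uniform on them
    ([assignment_uniform]), so every expectation is a plain average over
    assignments ([expectation_finite_uniform]), and the claim becomes a finite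
    computation.

    Two features of the average over assignments matter.  A uniformly random
    permutation sends a given level to a uniformly random place, hence
    [tauhat_block b] has mean [taubar_block b]; and a uniform family has
    independent coordinates, hence [tauhat_block b] and [tauhat_block b'] are
    uncorrelated for distinct blocks.  The conclusion then holds for any
    pairwise uncorrelated [x_b] with means [m_b] ([average_sample_variance]):
    writing [x_b ^+ 2 = var x_b + m_b ^+ 2] on average, the sum of squared
    deviations from the sample mean has average
    [(1 - B^-1) * \sum_b var x_b + \sum_b (m_b - mbar) ^+ 2], and dividing by
    [B * (B - 1)] leaves the variance of the sample mean plus the dispersion
    of the [m_b]. *)

(** * Averages over a finite type *)

Definition average (R : realType) (T : finType) (f : T -> R) : R :=
  #|T|%:R^-1 * \sum_t f t.

Section Average.
Context {R : realType} {T : finType}.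
Implicit Types (f g : T -> R) (c : R).

Lemma eq_average f g : f =1 g -> average f = average g.
Proof. by move=> fg; congr (_ * _); apply: eq_bigr => t _; exact: fg. Qed.

Lemma averageD f g : average (fun t => f t + g t) = average f + average g.
Proof. by rewrite /average big_split mulrDr. Qed.

Lemma averageZ c f : average (fun t => c * f t) = c * average f.
Proof. by rewrite /average -mulr_sumr mulrCA. Qed.

Lemma average_sum (I : finType) (F : I -> T -> R) :
  average (fun t => \sum_i F i t) = \sum_i average (F i).
Proof. by rewrite /average exchange_big mulr_sumr. Qed.

Lemma average_cst c : (0 < #|T|)%N -> average (fun _ : T => c) = c.
Proof.
move=> T_gt0; have T_neq0 : #|T|%:R != 0 :> R by rewrite pnatr_eq0 -lt0n.
by rewrite /average sumr_const -[c *+ _]mulr_natl; apply: mulKf.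
Qed.

End Average.

(** Relabelling the source by a transposition shows that the left-hand side is
    the same for all [p]; averaging it over [p] then gives, for each [s], a
    sum over all of ['I_n] that [s] merely reorders. *)
Lemma average_perm (R : realType) (n : nat) (f : 'I_n -> R) (p : 'I_n) :
  average (fun s : 'S_n => f (s p)) = average f.
Proof.
have cardS : (0 < #|{: 'S_n}|)%N by apply/card_gt0P; exists 1%g.
have n_gt0 : (0 < #|'I_n|)%N by apply/card_gt0P; exists p.
have invariant p' :
    average (fun s : 'S_n => f (s p')) = average (fun s : 'S_n => f (s p)).
  congr (_ * _); rewrite (reindex_inj (mulgI (tperm p p'))) /=.
  by apply: eq_bigr => s _; rewrite permM tpermR.
transitivity (average (fun p' => average (fun s : 'S_n => f (s p')))).
  by rewrite (eq_average invariant) average_cst.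
rewrite -[RHS](average_cst _ cardS) /average -!mulr_sumr exchange_big mulrCA.
congr (_ * (_ * _)).
by apply: eq_bigr => s _; rewrite [RHS](reindex_inj (@perm_inj _ s)).
Qed.

Lemma average_pair (R : realType) (S T : finType) (f : S -> T -> R) :
  average (fun u : S * T => f u.1 u.2)
  = average (fun s => average (fun t => f s t)).
Proof.
rewrite /average card_prod natrM invfM -mulr_sumr mulrA; congr (_ * _).
by rewrite pair_big.
Qed.

Lemma average_prod (R : realType) (I J : finType) (g : I -> J -> R) :
  average (fun z : {ffun I -> J} => \prod_i g i (z i))
  = \prod_i average (g i).
Proof.
rewrite /average big_split /= bigA_distr_bigA prodr_const card_ffun.
by rewrite natrX exprVn.
Qed.

Lemma average_coord (R : realType) (I J : finType) (i : I) (g : J -> R) :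
  (0 < #|J|)%N -> average (fun z : {ffun I -> J} => g (z i)) = average g.
Proof.
(* One coordinate is a product over all of them with the other factors 1. *)
move=> J_gt0; pose G k : J -> R := if k == i then g else fun=> 1.
transitivity (average (fun z : {ffun I -> J} => \prod_k G k (z k))).
  apply: eq_average => z; rewrite (bigD1 i) //= /G eqxx big1 ?mulr1 //.
  by move=> k /negPf->.
rewrite average_prod (bigD1 i) //= /G eqxx big1 ?mulr1 // => k /negPf->.
exact: average_cst.
Qed.

(** The coordinates of a uniform family are independent. *)
Lemma average_coordM (R : realType) (I J : finType) (i j : I)
    (g h : J -> R) : (0 < #|J|)%N -> i != j ->
  average (fun z : {ffun I -> J} => g (z i) * h (z j))
  = average g * average h.
Proof.
move=> J_gt0 ij.
pose G k : J -> R := if k == i then g else if k == j then h else fun=> 1.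
have ji : (j == i) = false by rewrite eq_sym (negPf ij).
transitivity (average (fun z : {ffun I -> J} => \prod_k G k (z k))).
  apply: eq_average => z; rewrite (bigD1 i) // (bigD1 j) ?ji //=.
  rewrite /G eqxx ji eqxx big1 ?mulr1 // => k /andP[/negPf-> /negPf->] //.
rewrite average_prod (bigD1 i) // (bigD1 j) ?ji //= /G eqxx ji eqxx.
rewrite big1 ?mulr1 // => k /andP[/negPf-> /negPf->]; exact: average_cst.
Qed.

(** * The sample variance of uncorrelated variables *)

Lemma sum_sqr_deviation (R : realType) (B : nat) (x : 'I_B -> R) :
  (0 < B)%N ->
  \sum_b (x b - B%:R^-1 * \sum_c x c) ^+ 2
  = \sum_b x b ^+ 2 - B%:R^-1 * (\sum_b x b) ^+ 2.
Proof.
move=> B_gt0; have B_neq0 : B%:R != 0 :> R by rewrite pnatr_eq0 -lt0n.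
set s := \sum_c x c.
transitivity (\sum_b (x b ^+ 2 - (2 * (B%:R^-1 * s)) * x b
                      + (B%:R^-1 * s) ^+ 2)).
  by apply: eq_bigr => b _; ring.
rewrite !big_split /= sumrN -mulr_sumr -/s sumr_const card_ord -mulr_natl.
by field.
Qed.

Lemma sqr_sum_diag (R : realType) (B : nat) (x : 'I_B -> R) :
  (\sum_b x b) ^+ 2
  = \sum_b x b ^+ 2 + \sum_b \sum_(c | c != b) x b * x c.
Proof.
rewrite expr2 mulr_suml -big_split /=; apply: eq_bigr => b _.
by rewrite mulr_sumr (bigD1 b) //= expr2.
Qed.

Section SampleVariance.
Context {R : realType} {T : finType} {B : nat}.
Variables (x : 'I_B -> T -> R) (m : 'I_B -> R).
Hypotheses (T_gt0 : (0 < #|T|)%N) (B_ge2 : (2 <= B)%N).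
Hypothesis mean : forall b, average (x b) = m b.
Hypothesis uncorrelated : forall b c, b != c ->
  average (fun t => x b t * x c t) = m b * m c.

Let avg_sum : average (fun t => \sum_b x b t) = \sum_b m b.
Proof. by rewrite average_sum (eq_bigr _ (fun b _ => mean b)). Qed.

Let avg_sqr_sum : average (fun t => (\sum_b x b t) ^+ 2)
  = average (fun t => \sum_b x b t ^+ 2)
    + ((\sum_b m b) ^+ 2 - \sum_b m b ^+ 2).
Proof.
under eq_average do rewrite sqr_sum_diag.
rewrite averageD; congr (_ + _).
rewrite sqr_sum_diag addrAC subrr add0r average_sum.
apply: eq_bigr => b _; rewrite /average exchange_big mulr_sumr /=.
by apply: eq_bigr => c cb; rewrite -uncorrelated // eq_sym.
Qed.

(** The average of the squared sum exceeds the average of the sum of squares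
    only by the cross terms [m b * m c], so both sides are combinations of
    [average (\sum_b x b ^+ 2)], [\sum_b m b ^+ 2] and [\sum_b m b]. *)
Lemma average_sample_variance :
  average (fun t => (B * (B - 1))%:R^-1
                    * \sum_b (x b t - B%:R^-1 * \sum_c x c t) ^+ 2)
  = average (fun t => (B%:R^-1 * \sum_b x b t
                       - average (fun t => B%:R^-1 * \sum_b x b t)) ^+ 2)
    + (B * (B - 1))%:R^-1 * \sum_b (m b - B%:R^-1 * \sum_c m c) ^+ 2.
Proof.
have B_gt0 : (0 < B)%N := ltnW B_ge2.
have B_neq0 : B%:R != 0 :> R by rewrite pnatr_eq0 -lt0n.
have B1_neq0 : B%:R - 1 != 0 :> R by rewrite subr_eq0 pnatr_eq1 gtn_eqF.
rewrite !averageZ avg_sum sum_sqr_deviation //.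
under eq_average do rewrite sum_sqr_deviation // -mulNr.
rewrite averageD averageZ avg_sqr_sum.
set M := \sum_b m b; set A := average _.
have -> : average (fun t => (B%:R^-1 * \sum_b x b t - B%:R^-1 * M) ^+ 2)
    = B%:R^-2 * (A + (M ^+ 2 - \sum_b m b ^+ 2)) - (B%:R^-1 * M) ^+ 2.
  transitivity (average (fun t => B%:R^-2 * (\sum_b x b t) ^+ 2
    + (- (2 * (B%:R^-1 * M)) * (B%:R^-1 * \sum_b x b t)
       + (B%:R^-1 * M) ^+ 2))).
    by apply: eq_average => t; field.
  rewrite !averageD average_cst // !averageZ avg_sum avg_sqr_sum.
  by rewrite -/A -/M; ring.
by rewrite natrM natrB //; field; rewrite B_neq0.
Qed.

End SampleVariance.

(** * Expectations of functions of a finite uniform random element *)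

(** The hypotheses also give the integrability that a general expectation
    would require: [f \o Z] is a finite combination of indicators of the
    measurable fibres of [Z]. *)
Lemma expectation_finite_uniform (R : realType) (d : measure_display)
    (Omega : measurableType d) (Pr : probability Omega R) (T : finType)
    (Z : Omega -> T) (f : T -> R) :
    (forall t, measurable [set w | Z w = t]%classic) ->
    (forall t, Pr [set w | Z w = t]%classic = (#|T|%:R^-1)%:E) ->
  'E_Pr[fun w => f (Z w)]%E = (average f)%:E.
Proof.
move=> mZ uZ; rewrite unlock.
have decomp w : ((f (Z w))%:E =
    \sum_(t : T) (f t)%:E * (\1_([set w | Z w = t]%classic) w)%:E)%E.
  rewrite (bigD1 (Z w)) //= big1 ?adde0.
    by rewrite indicE mem_set // mule1.
  by move=> t tZ; rewrite indicE memNset ?mule0 //= => /esym/eqP; apply/negP.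
have intg t : Pr.-integrable setT
    (fun w => (\1_([set w | Z w = t]%classic) w)%:E).
  exact: integrable_indic.
under eq_integral do rewrite decomp.
rewrite integral_sum //; last by move=> t; exact: integrableZl.
rewrite /average mulr_sumr -sumEFin; apply: eq_bigr => t _.
rewrite integralZl // integral_indic // setIT.
by rewrite [X in (_ * X)%E](uZ t) -EFinM mulrC.
Qed.

Lemma variance_finite_uniform (R : realType) (d : measure_display)
    (Omega : measurableType d) (Pr : probability Omega R) (T : finType)
    (Z : Omega -> T) (f : T -> R) :
    (forall t, measurable [set w | Z w = t]%classic) ->
    (forall t, Pr [set w | Z w = t]%classic = (#|T|%:R^-1)%:E) ->
  'V_Pr[fun w => f (Z w)]%E = (average (fun t => (f t - average f) ^+ 2))%:E.
Proof.
move=> mZ uZ; rewrite /variance unlock expectation_finite_uniform //=.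
exact: (expectation_finite_uniform (fun t => (f t - average f) ^+ 2)).
Qed.

(** * The strip-plot assignment *)

Notation assignment B P Q := {ffun 'I_B -> 'S_P * 'S_Q}.

Definition rows {B P Q : nat} (b : 'I_B) (z : assignment B P Q) : 'S_P :=
  (z b).1.

Definition cols {B P Q : nat} (b : 'I_B) (z : assignment B P Q) : 'S_Q :=
  (z b).2.

Section Assignment.
Context {R : realType} {d : measure_display} {Omega : measurableType d}.
Context {Pr : probability Omega R} {B P Q : nat}.
Context {rowF : 'I_B -> Omega -> 'S_P} {colG : 'I_B -> Omega -> 'S_Q}.
Hypothesis hrand : strip_plot_randomization Pr rowF colG.

Let Z (w : Omega) : assignment B P Q := [ffun b => (rowF b w, colG b w)].

Let fibreE z : [set w | Z w = z]%classic =
  [set w | forall b, rowF b w = rows b z /\ colG b w = cols b z]%classic.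
Proof.
apply/seteqP; split => w /=.
  by move=> <- b; rewrite /rows /cols ffunE.
move=> zw; apply/ffunP => b; rewrite ffunE.
by have [-> ->] := zw b; rewrite -surjective_pairing.
Qed.

Lemma assignment_measurable z : measurable [set w | Z w = z]%classic.
Proof.
rewrite fibreE.
have -> : [set w | forall b, rowF b w = rows b z /\ colG b w = cols b z]%classic
  = (\bigcap_b ([set w | rowF b w = rows b z]
                `&` [set w | colG b w = cols b z]))%classic.
  by apply/seteqP; split=> [w zw b _ | w zw b]; [exact: zw | exact: zw b I].
apply: fin_bigcap_measurable => [|b _]; first exact: finite_finset.
apply: measurableI.
  exact: rowF_measurable hrand _ _.
exact: colG_measurable hrand _ _.
Qed.

(** Joint independence, applied to singletons, gives an assignment probability
    [(P`!)^-1 ^+ B * (Q`!)^-1 ^+ B], the inverse of the number of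
    assignments. *)
Lemma assignment_uniform z :
  Pr [set w | Z w = z]%classic = (#|{: assignment B P Q}|%:R^-1)%:E.
Proof.
rewrite fibreE.
have := strip_indep hrand (fun b => [set rows b z]%SET)
  (fun b => [set cols b z]%SET).
have -> : [set w | forall b, rowF b w \in [set rows b z]%SET
    /\ colG b w \in [set cols b z]%SET]%classic
  = [set w | forall b, rowF b w = rows b z /\ colG b w = cols b z]%classic.
  by apply/seteqP; split => w /= zw b; have := zw b; rewrite !inE;
    [move=> [/eqP-> /eqP->] | move=> [-> ->]].
move=> ->.
have rowE b : Pr [set w | rowF b w \in [set rows b z]%SET]%classic
    = ((P`!)%:R^-1)%:E.
  rewrite -(rowF_uniform hrand b (rows b z)); congr (Pr _).
  by apply/seteqP; split => w /=; rewrite inE => /eqP.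
have colE b : Pr [set w | colG b w \in [set cols b z]%SET]%classic
    = ((Q`!)%:R^-1)%:E.
  rewrite -(colG_uniform hrand b (cols b z)); congr (Pr _).
  by apply/seteqP; split => w /=; rewrite inE => /eqP.
rewrite (eq_bigr _ (fun b _ => rowE b)) (eq_bigr _ (fun b _ => colE b)).
rewrite !prodEFin -EFinM !prodr_const card_ord card_ffun card_prod !card_Sn.
by rewrite card_ord natrX natrM exprMn invfM !exprVn.
Qed.

End Assignment.

(** A block estimate averages [l p q * Y b (s p) (t q) p q] over independent
    uniform permutations [s] and [t], which replaces [s p] and [t q] by a
    uniformly random row and column. *)
Lemma average_tauhat_block (R : realType) (B P Q : nat)
    (Y : 'I_B -> 'I_P -> 'I_Q -> 'I_P -> 'I_Q -> R) (l : 'I_P -> 'I_Q -> R)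
    (b : 'I_B) :
  average (fun u : 'S_P * 'S_Q =>
    \sum_p \sum_q l p q * Y b (u.1 p) (u.2 q) p q) = taubar_block Y l b.
Proof.
rewrite average_sum; apply: eq_bigr => p _.
rewrite average_sum; apply: eq_bigr => q _.
rewrite averageZ (average_pair (fun (s : 'S_P) (t : 'S_Q) => Y b (s p) (t q) p q)).
congr (_ * _).
under eq_average => s do rewrite (average_perm (fun c => Y b (s p) c p q)).
rewrite (average_perm (fun r => average (fun c => Y b r c p q))).
by rewrite /Ybar /average -mulr_sumr mulrA !card_ord natrM invfM.
Qed.

Theorem theorem2 (R : realType) (d : measure_display) (Omega : measurableType d)
    (Pr : probability Omega R) (B P Q : nat)
    (hB : (2 <= B)%N) (hP : (2 <= P)%N) (hQ : (2 <= Q)%N)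
    (rowF : 'I_B -> Omega -> 'S_P) (colG : 'I_B -> Omega -> 'S_Q)
    (hrand : strip_plot_randomization Pr rowF colG)
    (Y : 'I_B -> 'I_P -> 'I_Q -> 'I_P -> 'I_Q -> R)
    (l : 'I_P -> 'I_Q -> R)
    (hl_neq0 : exists (p : 'I_P) (q : 'I_Q), l p q <> 0)
    (hl_sum0 : \sum_(p < P) \sum_(q < Q) l p q = 0) :
  ('E_Pr[varhat0 Y l rowF colG]
   = 'V_Pr[tauhat Y l rowF colG] + (Delta0 Y l)%:E)%E.
Proof.
(* The definitions of the estimators accept any sample space, so the estimators
   on [Omega] are those on the space of assignments composed with [Z]. *)
pose Z w : assignment B P Q := [ffun b => (rowF b w, colG b w)].
have rowZ : rowF = fun b w => rows b (Z w).
  by apply/funext => b; apply/funext => w; rewrite /rows ffunE.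
have colZ : colG = fun b w => cols b (Z w).
  by apply/funext => b; apply/funext => w; rewrite /cols ffunE.
have mZ := assignment_measurable hrand.
have uZ := assignment_uniform hrand.
have -> : varhat0 Y l rowF colG = fun w => varhat0 Y l rows cols (Z w).
  by rewrite {1}rowZ {1}colZ.
have -> : tauhat Y l rowF colG = fun w => tauhat Y l rows cols (Z w).
  by rewrite {1}rowZ {1}colZ.
rewrite expectation_finite_uniform // variance_finite_uniform // -EFinD.
congr (_%:E).
have S_gt0 : (0 < #|{: 'S_P * 'S_Q}|)%N by apply/card_gt0P; exists (1%g, 1%g).
apply: average_sample_variance => //.
- by rewrite card_ffun expn_gt0 S_gt0.
- move=> b; rewrite -average_tauhat_block.
  exact: (average_coord b (fun u : 'S_P * 'S_Q =>
    \sum_p \sum_q l p q * Y b (u.1 p) (u.2 q) p q)).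
- move=> b c bc; rewrite -!average_tauhat_block.
  exact: (average_coordM (fun u : 'S_P * 'S_Q =>
      \sum_p \sum_q l p q * Y b (u.1 p) (u.2 q) p q)
    (fun u : 'S_P * 'S_Q => \sum_p \sum_q l p q * Y c (u.1 p) (u.2 q) p q)).
Qed.
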